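(* There is a one-to-one correspondence between skeletal $A_\infty$-conformal algebras $(\mathcal{A}_1\xrightarrow{0}\mathcal{A}_0,\mu_2,\mu_3)$ and tuples $(A,M,\Theta)$ in which $A$ is an associative conformal algebra, $M$ is a conformal $A$-bimodule and $\Theta\in Z^3(A,M)$ is a $3$-cocycle (the correspondence being $A=\mathcal{A}_0$ and $M=\mathcal{A}_1$, with $\lambda$-multiplication and left and right $\lambda$-actions given by $\mu_2$, and $\Theta=\mu_3$). Moreover, this extends to a one-to-one correspondence between the equivalence classes of skeletal $A_\infty$-conformal algebras and tuples $(A,M,[\Theta])$, where $[\Theta]\in H^3(A,M)$.
   Context: All vector spaces, linear maps and tensor products are over $\mathbb{C}$. For $\mathbb{C}[\partial]$-modules, a $\mathbb{C}$-linear map $\varphi$ from an $n$-fold tensor product to $M[\lambda_1,\ldots,\lambda_{n-1}]$ is conformal sesquilinear if $\varphi_{\lambda_1,\ldots,\lambda_{n-1}}(a_1,\ldots,\partial a_i,\ldots,a_n)=-\lambda_i\varphi_{\lambda_1,\ldots,\lambda_{n-1}}(a_1,\ldots,a_n)$ for $i\le n-1$ and $\varphi_{\lambda_1,\ldots,\lambda_{n-1}}(a_1,\ldots,a_{n-1},\partial a_n)=(\partial+\lambda_1+\cdots+\lambda_{n-1})\varphi_{\lambda_1,\ldots,\lambda_{n-1}}(a_1,\ldots,a_n)$. An associative conformal algebra is a $\mathbb{C}[\partial]$-module $A$ with a conformal sesquilinear map $A\otimes A\to A[\lambda]$, $a\otimes b\mapsto a_\lambda b$, with $a_\lambda(b_\mu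 c)=(a_\lambda b)_{\lambda+\mu}c$. A conformal $A$-bimodule is a $\mathbb{C}[\partial]$-module $M$ with conformal sesquilinear maps $A\otimes M\to M[\lambda]$, $a\otimes m\mapsto a_\lambda m$, and $M\otimes A\to M[\lambda]$, $m\otimes a\mapsto m_\lambda a$, such that $a_\lambda(b_\mu m)=(a_\lambda b)_{\lambda+\mu}m$, $a_\lambda(m_\mu b)=(a_\lambda m)_{\lambda+\mu}b$, $m_\lambda(a_\mu b)=(m_\lambda a)_{\lambda+\mu}b$. Hochschild complex: for $n\ge1$, $C^n(A,M)$ is the space of conformal sesquilinear maps $A^{\otimes n}\to M[\lambda_1,\ldots,\lambda_{n-1}]$, and $$(\delta\varphi)_{\lambda_1,\ldots,\lambda_n}(a_1,\ldots,a_{n+1})={a_1}_{\lambda_1}\varphi_{\lambda_2,\ldots,\lambda_n}(a_2,\ldots,a_{n+1})+\sum_{i=1}^n(-1)^i\varphi_{\lambda_1,\ldots,\lambda_{i-1},\lambda_i+\lambda_{i+1},\lambda_{i+2},\ldots,\lambda_n}(a_1,\ldots,{a_i}_{\lambda_i}a_{i+1},\ldots,a_{n+1})+(-1)^{n+1}\big(\varphi_{\lambda_1,\ldots,\lambda_{n-1}}(a_1,\ldots,a_n)\big)_{\lambda_1+\cdots+\lambda_n}a_{n+1}$$ (for $i=n$ the subscripts of $\varphi$ are $\lambda_1,\ldots,\lambda_{n-1}$). $Z^3(A,M)=\ker(\delta|_{C^3})$ and $H^3(A,M)=Z^3(A,M)/\delta C^2(A,M)$. A $2$-term $A_\infty$-conformal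 algebra $(\mathcal{A}_1\xrightarrow{\beta}\mathcal{A}_0,\mu_2,\mu_3)$ consists of $\mathbb{C}[\partial]$-modules $\mathcal{A}_0,\mathcal{A}_1$, a $\mathbb{C}[\partial]$-linear map $\beta$, conformal sesquilinear maps $\mu_2:\mathcal{A}_i\otimes\mathcal{A}_j\to\mathcal{A}_{i+j}[\lambda]$ ($0\le i,j,i+j\le1$; and $\mu_2=0$ on $\mathcal{A}_1\otimes\mathcal{A}_1$), and a conformal sesquilinear map $\mu_3:\mathcal{A}_0^{\otimes3}\to\mathcal{A}_1[\lambda_1,\lambda_2]$ such that, writing $x_\lambda y=(\mu_2)_\lambda(x,y)$, for $a,b,c,d\in\mathcal{A}_0$, $m,n\in\mathcal{A}_1$: $\beta(a_\lambda m)=a_\lambda(\beta m)$; $\beta(m_\lambda a)=(\beta m)_\lambda a$; $(\beta m)_\lambda n=m_\lambda(\beta n)$; $\beta((\mu_3)_{\lambda_1,\lambda_2}(a,b,c))=(a_{\lambda_1}b)_{\lambda_1+\lambda_2}c-a_{\lambda_1}(b_{\lambda_2}c)$; $(\mu_3)_{\lambda_1,\lambda_2}(a,b,\beta m)=(a_{\lambda_1}b)_{\lambda_1+\lambda_2}m-a_{\lambda_1}(b_{\lambda_2}m)$; $(\mu_3)_{\lambda_1,\lambda_2}(a,\beta m,c)=(a_{\lambda_1}m)_{\lambda_1+\lambda_2}c-a_{\lambda_1}(m_{\lambda_2}c)$; $(\mu_3)_{\lambda_1,\lambda_2}(\beta m,b,c)=(m_{\lambda_1}b)_{\lambda_1+\lambda_2}c-m_{\lambda_1}(b_{\lambda_2}c)$;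 $(\mu_3)_{\lambda_1+\lambda_2,\lambda_3}(a_{\lambda_1}b,c,d)-(\mu_3)_{\lambda_1,\lambda_2+\lambda_3}(a,b_{\lambda_2}c,d)+(\mu_3)_{\lambda_1,\lambda_2}(a,b,c_{\lambda_3}d)=\big((\mu_3)_{\lambda_1,\lambda_2}(a,b,c)\big)_{\lambda_1+\lambda_2+\lambda_3}d+a_{\lambda_1}(\mu_3)_{\lambda_2,\lambda_3}(b,c,d)$. It is skeletal if $\beta=0$. Two skeletal $A_\infty$-conformal algebras $(\mathcal{A}_1\xrightarrow{0}\mathcal{A}_0,\mu_2,\mu_3)$ and $(\mathcal{A}_1\xrightarrow{0}\mathcal{A}_0,\mu_2',\mu_3')$ on the same underlying graded $\mathbb{C}[\partial]$-module are equivalent if $\mu_2=\mu_2'$ and there is a conformal sesquilinear map $\sigma:\mathcal{A}_0\otimes\mathcal{A}_0\to\mathcal{A}_1[\lambda]$ with $$(\mu_3')_{\lambda_1,\lambda_2}(a,b,c)=(\mu_3)_{\lambda_1,\lambda_2}(a,b,c)+a_{\lambda_1}\sigma_{\lambda_2}(b,c)-\sigma_{\lambda_1+\lambda_2}(a_{\lambda_1}b,c)+\sigma_{\lambda_1}(a,b_{\lambda_2}c)-\big(\sigma_{\lambda_1}(a,b)\big)_{\lambda_1+\lambda_2}c.$$ *)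

(* Defs.v *)
From HB Require Import structures.
From mathcomp Require Import all_boot all_order all_algebra.
From mathcomp Require Import finmap.
From mathcomp Require Import -(notations) monalg.
From mathcomp Require Import mpoly.

Set Implicit Arguments.
Unset Strict Implicit.
Unset Printing Implicit Defensive.

Import GRing.Theory.
Local Open Scope ring_scope.

(* A C[d]-module is an [lmodType {poly K}]: ['X] acts as the derivation d and
   [c%:P] as the scalar [c].                                                  *)

Section LambdaPoly.
Context {R : comNzRingType}.
Implicit Types (n : nat) (M : lmodType R).

(* M[lambda_1, ..., lambda_n]: finitely supported families of coefficients in
   M indexed by the monomials in n variables (numbered from 0).               *)
Definition lpoly n M : Type := monalg.malg 'X_{1..n} M.

HB.instance Definition _ n M := GRing.Zmodule.on (lpoly n M).

Definition lmon n M (m : 'X_{1..n}) (x : M) : lpoly n M := monalg.mkmalgU m x.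
Definition lcoef n M (m : 'X_{1..n}) (q : lpoly n M) : M := monalg.mcoeff m q.
Definition lsupp n M (q : lpoly n M) : seq 'X_{1..n} := monalg.msupp q.

End LambdaPoly.

(* sum over the monomials of q, for E m additive *)
HB.lock Definition lsum (R : comNzRingType) n (M : lmodType R) (V : zmodType)
    (E : 'X_{1..n} -> M -> V) (q : lpoly n M) : V :=
  \sum_(m <- lsupp q) E m (lcoef m q).
Canonical lsum_unlockable := Unlockable lsum.unlock.

Section LambdaPolyTheory.
Context {R : comNzRingType}.
Implicit Types (n : nat) (M : lmodType R).

Lemma lcoefP n M (p q : lpoly n M) : (forall m, lcoef m p = lcoef m q) -> p = q.
Proof. by move=> h; apply/malgP. Qed.

Lemma lcoefD n M m (p q : lpoly n M) : lcoef m (p + q) = lcoef m p + lcoef m q.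
Proof. exact: monalg.mcoeffD. Qed.

Lemma lcoef_mon n M (m m' : 'X_{1..n}) (x : M) : lcoef m' (lmon m x) = x *+ (m == m').
Proof. exact: monalg.mcoeffU. Qed.

Lemma lmonD n M (m : 'X_{1..n}) (x y : M) : lmon m (x + y) = lmon m x + lmon m y.
Proof. exact: monalg.monalgUD. Qed.

Lemma lmon0 n M (m : 'X_{1..n}) : lmon m (0 : M) = 0.
Proof. exact: monalg.monalgU0. Qed.

Lemma lpolyE n M (q : lpoly n M) : q = lsum (@lmon R n M) q.
Proof. by rewrite lsum.unlock; exact: monalg.monalgE. Qed.

Lemma lsumw n M (V : zmodType) (E : 'X_{1..n} -> M -> V) (q : lpoly n M)
    (s : seq 'X_{1..n}) :
  (forall m, E m 0 = 0) -> uniq s -> {subset lsupp q <= s} ->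
  lsum E q = \sum_(m <- s) E m (lcoef m q).
Proof.
move=> E0 us sub; rewrite lsum.unlock [RHS](bigID (fun m => m \in lsupp q)) /=.
rewrite [X in _ + X]big1 ?addr0; last first.
  by move=> m; rewrite /lcoef => /mcoeff_outdom ->.
rewrite -[RHS]big_filter; apply: perm_big; apply: uniq_perm.
- exact: fset_uniq.
- exact: filter_uniq.
by move=> m; rewrite mem_filter; case: (boolP (m \in _)) => // /sub ->.
Qed.

Lemma lsumD n M (V : zmodType) (E : 'X_{1..n} -> M -> V) (p q : lpoly n M) :
  (forall m, {morph E m : x y / x + y}) -> lsum E (p + q) = lsum E p + lsum E q.
Proof.
move=> ED; have E0 m : E m 0 = 0.
  by apply: (@addrI _ (E m 0)); rewrite -ED !addr0.
pose s := undup (lsupp p ++ lsupp q ++ lsupp (p + q)).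
have us : uniq s by exact: undup_uniq.
rewrite !(@lsumw _ _ _ E _ s) //;
  try by move=> m mp; rewrite mem_undup !mem_cat mp ?orbT.
by rewrite -big_split; apply: eq_bigr => m _; rewrite lcoefD ED.
Qed.

Lemma lsum_mon n M (V : zmodType) (E : 'X_{1..n} -> M -> V) m x :
  (forall m', E m' 0 = 0) -> lsum E (lmon m x) = E m x.
Proof.
move=> E0; rewrite (@lsumw _ _ _ E _ [:: m]) //.
  by rewrite big_seq1 lcoef_mon eqxx.
move=> m'; rewrite /lsupp msuppU; case: eqP => _; rewrite !inE //.
Qed.

(* M[lambda_1, ..., lambda_n] is a module over R[lambda_1, ..., lambda_n] *)
Definition lscale n M (p : {mpoly R[n]}) (q : lpoly n M) : lpoly n M :=
  \sum_(m <- msupp p) lsum (fun k x => lmon (m + k)%MM (p@_m *: x)) q.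

Lemma lscalew n M (p : {mpoly R[n]}) (q : lpoly n M) (s : seq 'X_{1..n}) :
  uniq s -> {subset msupp p <= s} ->
  lscale p q = \sum_(m <- s) lsum (fun k x => lmon (m + k)%MM (p@_m *: x)) q.
Proof.
move=> us sub; rewrite [RHS](bigID (fun m => m \in msupp p)) /=.
rewrite [X in _ + X]big1 ?addr0; last first.
  move=> m /memN_msupp_eq0 ->; rewrite lsum.unlock big1 // => k _.
  by rewrite scale0r lmon0.
rewrite -big_filter; apply: perm_big; apply: uniq_perm.
- exact: msupp_uniq.
- exact: filter_uniq.
by move=> m; rewrite mem_filter; case: (boolP (m \in _)) => // /sub ->.
Qed.

Lemma lscaleDr n M (p : {mpoly R[n]}) :
  {morph @lscale n M p : q r / q + r}.
Proof.
move=> q r; rewrite /lscale -big_split; apply: eq_bigr => m _ /=.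
by apply: lsumD => k x y; rewrite scalerDr lmonD.
Qed.

Lemma lscaleDl n M (q : lpoly n M) :
  {morph (@lscale n M)^~ q : p1 p2 / p1 + p2}.
Proof.
move=> p1 p2 /=.
pose s := undup (msupp p1 ++ msupp p2 ++ msupp (p1 + p2)).
have us : uniq s by exact: undup_uniq.
rewrite !(@lscalew _ _ _ _ s) //;
  try by move=> m mp; rewrite mem_undup !mem_cat mp ?orbT.
rewrite -big_split; apply: eq_bigr => m _ /=.
rewrite lsum.unlock -big_split; apply: eq_bigr => k _ /=.
by rewrite mcoeffD scalerDl lmonD.
Qed.

Lemma lscale0 n M (p : {mpoly R[n]}) : lscale p (0 : lpoly n M) = 0.
Proof. by apply: (@addrI _ (lscale p 0)); rewrite -lscaleDr !addr0. Qed.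

Lemma lscale0l n M (q : lpoly n M) : lscale 0 q = 0.
Proof. by apply: (@addrI _ (lscale 0 q)); rewrite -lscaleDl !addr0. Qed.

Lemma lscale_mon n M (c : R) (m k : 'X_{1..n}) (x : M) :
  lscale (c *: 'X_[R, m]) (lmon k x : lpoly n M) = lmon (m + k)%MM (c *: x).
Proof.
rewrite (@lscalew _ _ _ _ [:: m]) //; last by move=> m'; move/msuppZ_le; rewrite msuppX.
rewrite big_seq1 lsum_mon => [|m']; last by rewrite scaler0 lmon0.
by rewrite mcoeffZ mcoeffX eqxx mulr1.
Qed.

Lemma lscale_suml n M I (r : seq I) (F : I -> {mpoly R[n]}) (q : lpoly n M) :
  lscale (\sum_(i <- r) F i) q = \sum_(i <- r) lscale (F i) q.
Proof. exact: (big_morph _ (lscaleDl q) (lscale0l q)). Qed.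

Lemma lscale_sumr n M I (r : seq I) p (F : I -> lpoly n M) :
  lscale p (\sum_(i <- r) F i) = \sum_(i <- r) lscale p (F i).
Proof. exact: (big_morph _ (lscaleDr p) (lscale0 _ p)). Qed.

Lemma lscaleA n M p1 p2 (q : lpoly n M) :
  lscale p1 (lscale p2 q) = lscale (p1 * p2) q.
Proof.
rewrite [q]lpolyE lsum.unlock (lscale_sumr _ p2) (lscale_sumr _ p1) (lscale_sumr _ (p1 * p2)).
apply: eq_bigr => k _.
rewrite [in RHS](mpolyE p1) [in LHS](mpolyE p1) mulr_suml !lscale_suml.
apply: eq_bigr => m1 _; rewrite [in RHS](mpolyE p2) [in LHS](mpolyE p2).
rewrite mulr_sumr !lscale_suml lscale_sumr; apply: eq_bigr => m2 _.
rewrite -scalerAl -scalerAr scalerA -mpolyXD !lscale_mon.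
by rewrite scalerA addmA.
Qed.

Lemma lscale1 n M (q : lpoly n M) : lscale 1 q = q.
Proof.
rewrite [q in LHS]lpolyE [RHS]lpolyE lsum.unlock lscale_sumr; apply: eq_bigr => k _.
have -> : 1 = 1 *: 'X_[R, 0%MM] :> {mpoly R[n]} by rewrite mpolyX0 scale1r.
by rewrite lscale_mon add0m scale1r.
Qed.

HB.instance Definition _ n M := GRing.Zmodule_isLmodule.Build {mpoly R[n]}
  (lpoly n M) (@lscaleA n M) (@lscale1 n M) (@lscaleDr n M) (@lscaleDl n M).

End LambdaPolyTheory.

Notation "{ 'lpoly' M [ n ] }" := (lpoly n M)
  (M at level 2, n at level 2, format "{ 'lpoly'  M [ n ] }") : type_scope.

Section LambdaOps.
Context {R : comNzRingType}.
Implicit Types (U V W X Y : lmodType R) (n : nat).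

(* q(u_0, ..., u_{k-1}) *)
Definition lsubst k n V (u : 'I_k -> {mpoly R[n]}) (q : {lpoly V[k]}) :
    {lpoly V[n]} :=
  lsum (fun m x => mmap1 u m *: lmon 0%MM x) q.

(* Extension of g to polynomials by linearity over the variables:
   sum_m lambda^m x_m  |->  sum_m lambda^m g(x_m).                            *)
Definition lext n V W (g : V -> {lpoly W[n]}) (q : {lpoly V[n]}) : {lpoly W[n]} :=
  lsum (fun m x => 'X_[m] *: g x) q.

(* h applied to each coefficient *)
Definition lmap n V W (h : V -> W) (q : {lpoly V[n]}) : {lpoly W[n]} :=
  lext (fun x => lmon 0%MM (h x)) q.

(* x_s y for a polynomial s in lambda_1, ..., lambda_n, where f is the
   lambda-operation x_lambda y.                                               *)
Definition lam n U V W (f : U -> V -> {lpoly W[1]}) (s : {mpoly R[n]}) x y :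
    {lpoly W[n]} :=
  lsubst (fun=> s) (f x y).

(* (x_{lambda_1} y)_{lambda_1 + lambda_2} z *)
Definition lam_l U V W X Y (f : U -> V -> {lpoly W[1]})
    (g : W -> X -> {lpoly Y[1]}) x y z : {lpoly Y[2]} :=
  lext (fun w => lam g ('X_ord0 + 'X_ord_max) w z) (lam f 'X_ord0 x y).

(* x_{lambda_1} (y_{lambda_2} z) *)
Definition lam_r U V W X Y (f : U -> W -> {lpoly Y[1]})
    (g : V -> X -> {lpoly W[1]}) x y z : {lpoly Y[2]} :=
  lext (fun w => lam f 'X_ord0 x w) (lam g 'X_ord_max y z).

End LambdaOps.

Section Conformal.
Context {K : fieldType}.
Implicit Types (U V W A M : lmodType {poly K}) (n : nat).

(* conformal sesquilinear maps U (x) V -> W[lambda] *)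
Definition sesquilinear2 U V W (f : U -> V -> {lpoly W[1]}) : Prop :=
  [/\ forall (c : K) x x' y, f (c%:P *: x + x') y = (c%:P)%:MP *: f x y + f x' y,
      forall (c : K) x y y', f x (c%:P *: y + y') = (c%:P)%:MP *: f x y + f x y',
      forall x y, f ('X *: x) y = - 'X_ord0 *: f x y
    & forall x y, f x ('X *: y) = ('X%:MP + 'X_ord0) *: f x y].

Definition tset n (T : Type) (i : 'I_n) (x : T) (a : n.-tuple T) : n.-tuple T :=
  [tuple if j == i then x else tnth a j | j < n].

(* conformal sesquilinear maps A^{(x) n+1} -> M[lambda_1, ..., lambda_n] *)
Definition sesquilinear n A M (phi : n.+1.-tuple A -> {lpoly M[n]}) : Prop :=
  [/\ forall (i : 'I_n.+1) (c : K) x y a, phi (tset i (c%:P *: x + y) a) =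
        (c%:P)%:MP *: phi (tset i x a) + phi (tset i y a),
      forall (i : 'I_n) x a, let i' := widen_ord (leqnSn n) i in
        phi (tset i' ('X *: x) a) = - 'X_i *: phi (tset i' x a)
    & forall x a, phi (tset ord_max ('X *: x) a) =
        ('X%:MP + \sum_(i < n) 'X_i) *: phi (tset ord_max x a)].

Record assoc_conf_alg := AssocConfAlg {
  aca_mod :> lmodType {poly K};
  aca_mul : aca_mod -> aca_mod -> {lpoly aca_mod[1]};
  aca_sesq : sesquilinear2 aca_mul;
  aca_assoc : forall a b c,
    lam_r aca_mul aca_mul a b c = lam_l aca_mul aca_mul a b c
}.

Record conf_bimodule (A : assoc_conf_alg) := ConfBimodule {
  cb_mod :> lmodType {poly K};
  cb_l : A -> cb_mod -> {lpoly cb_mod[1]};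
  cb_r : cb_mod -> A -> {lpoly cb_mod[1]};
  cb_l_sesq : sesquilinear2 cb_l;
  cb_r_sesq : sesquilinear2 cb_r;
  cb_ll : forall a b m, lam_r cb_l cb_l a b m = lam_l (@aca_mul A) cb_l a b m;
  cb_lr : forall a m b, lam_r cb_l cb_r a m b = lam_l cb_l cb_r a m b;
  cb_rr : forall m a b, lam_r cb_r (@aca_mul A) m a b = lam_l cb_r cb_r m a b
}.

Section Hochschild.
Variables (A : assoc_conf_alg) (M : conf_bimodule A).

Local Notation wid i := (widen_ord (leqnSn _) i).
Local Notation nxt i := (lift ord0 i).

(* (a_0, ..., a_{i-1}, x, a_{i+2}, ...), all indices starting from 0 *)
Definition merge_arg n (i : 'I_n.+1) (x : A) (a : n.+2.-tuple A) : n.+1.-tuple A :=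
  [tuple if (j < i)%N then tnth a (wid j)
         else if j == i then x else tnth a (nxt j) | j < n.+1].

(* (lambda_0, ..., lambda_i + lambda_{i+1}, lambda_{i+2}, ...); for i = n this
   is (lambda_0, ..., lambda_{n-1}).                                          *)
Definition merge_var n (i : 'I_n.+1) (j : 'I_n) : {mpoly {poly K}[n.+1]} :=
  if (j < i)%N then 'X_(wid j)
  else if j == i :> nat then 'X_(wid j) + 'X_(nxt j) else 'X_(nxt j).

(* the Hochschild differential C^{n+1}(A, M) -> C^{n+2}(A, M); as indices start
   from 0, the i-th summand carries the sign (-1)^{i+1} *)
Definition hdelta n (phi : n.+1.-tuple A -> {lpoly M[n]})
    (a : n.+2.-tuple A) : {lpoly M[n.+1]} :=
  lext (fun x => lam (@cb_l A M) 'X_ord0 (thead a) x)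
       (lsubst (fun j => 'X_(nxt j)) (phi [tuple of behead a]))
  + \sum_(i < n.+1) (-1) ^+ i.+1 *:
      lext (fun x => lsubst (merge_var i) (phi (merge_arg i x a)))
           (lam (@aca_mul A) 'X_i (tnth a (wid i)) (tnth a (nxt i)))
  + (-1) ^+ n.+2 *:
      lext (fun x => lam (@cb_r A M) (\sum_(i < n.+1) 'X_i) x (tnth a ord_max))
           (lsubst (fun j => 'X_(wid j)) (phi [tuple tnth a (wid j) | j < n.+1])).

(* C^{n+1}(A, M) *)
Record cochain n := Cochain {
  cochain_fun :> n.+1.-tuple A -> {lpoly M[n]};
  cochain_sesq : sesquilinear cochain_fun
}.

(* Z^{n+1}(A, M) *)
Record cocycle n := Cocycle {
  cocycle_cochain :> cochain n;
  cocycle_closed : forall a, hdelta cocycle_cochain a = 0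
}.

(* difference in delta C^{n+1}(A, M) *)
Definition cohomologous n (phi psi : cocycle n.+1) : Prop :=
  exists sigma : cochain n, forall a, psi a = phi a + hdelta sigma a.

End Hochschild.

(* The classes of a relation, as predicates; used for equivalence relations. *)
Definition quot (T : Type) (r : T -> T -> Prop) : Type :=
  {S : T -> Prop | exists x, S = r x}.
Definition qclass (T : Type) (r : T -> T -> Prop) (x : T) : quot r :=
  exist _ (r x) (ex_intro _ x erefl).

(* H^{n+2}(A, M) *)
Definition cohomology (A : assoc_conf_alg) (M : conf_bimodule A) n : Type :=
  quot (@cohomologous A M n).

(* mu_2 is zero on tt1 (x) tt1, so it amounts to mu00, mu01 and mu10. *)
Record two_term := TwoTerm {
  tt0 : lmodType {poly K};
  tt1 : lmodType {poly K};
  tt_beta : {linear tt1 -> tt0};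
  mu00 : tt0 -> tt0 -> {lpoly tt0[1]};
  mu01 : tt0 -> tt1 -> {lpoly tt1[1]};
  mu10 : tt1 -> tt0 -> {lpoly tt1[1]};
  mu3 : 3.-tuple tt0 -> {lpoly tt1[2]};
  mu00_sesq : sesquilinear2 mu00;
  mu01_sesq : sesquilinear2 mu01;
  mu10_sesq : sesquilinear2 mu10;
  mu3_sesq : sesquilinear mu3;
  tt_beta_l : forall a m,
    lmap tt_beta (mu01 a m) = mu00 a (tt_beta m);
  tt_beta_r : forall m a,
    lmap tt_beta (mu10 m a) = mu00 (tt_beta m) a;
  tt_beta_m : forall m m', mu01 (tt_beta m) m' = mu10 m (tt_beta m');
  tt_mu3_beta : forall a b c,
    lmap tt_beta (mu3 [tuple a; b; c]) =
    lam_l mu00 mu00 a b c - lam_r mu00 mu00 a b c;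
  tt_mu3_001 : forall a b m,
    mu3 [tuple a; b; tt_beta m] = lam_l mu00 mu01 a b m - lam_r mu01 mu01 a b m;
  tt_mu3_010 : forall a m c,
    mu3 [tuple a; tt_beta m; c] = lam_l mu01 mu10 a m c - lam_r mu01 mu10 a m c;
  tt_mu3_100 : forall m b c,
    mu3 [tuple tt_beta m; b; c] = lam_l mu10 mu10 m b c - lam_r mu10 mu00 m b c;
  tt_pentagon : forall a b c d,
    let l1 : {mpoly {poly K}[3]} := 'X_(inord 0) in
    let l2 : {mpoly {poly K}[3]} := 'X_(inord 1) in
    let l3 : {mpoly {poly K}[3]} := 'X_(inord 2) in
    let mu3_at (p q : {mpoly {poly K}[3]}) x y z :=
      lsubst (tnth [tuple p; q]) (mu3 [tuple x; y; z]) in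
    lext (fun x => mu3_at (l1 + l2) l3 x c d) (lam mu00 l1 a b)
    - lext (fun x => mu3_at l1 (l2 + l3) a x d) (lam mu00 l2 b c)
    + lext (fun x => mu3_at l1 l2 a b x) (lam mu00 l3 c d) =
    lext (fun x => lam mu10 (l1 + l2 + l3) x d) (mu3_at l1 l2 a b c)
    + lext (fun x => lam mu01 l1 a x) (mu3_at l2 l3 b c d)
}.

Record skeletal := Skeletal {
  skel_alg :> two_term;
  skel_beta : forall m, tt_beta skel_alg m = 0
}.

(* the underlying graded module with the operations, without axioms *)
Record operations := Operations {
  op0 : lmodType {poly K};
  op1 : lmodType {poly K};
  op00 : op0 -> op0 -> {lpoly op0[1]};
  op01 : op0 -> op1 -> {lpoly op1[1]};
  op10 : op1 -> op0 -> {lpoly op1[1]};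
  op3 : 3.-tuple op0 -> {lpoly op1[2]}
}.

Definition skel_ops (X : skeletal) : operations :=
  Operations (@mu00 X) (@mu01 X) (@mu10 X) (@mu3 X).

Variant ops_equiv : operations -> operations -> Prop :=
  OpsEquiv V0 V1 m00 m01 m10 m3 m3' (sigma : 2.-tuple V0 -> {lpoly V1[1]}) of
    sesquilinear sigma
  & (forall a b c,
       let l1 : {mpoly {poly K}[2]} := 'X_ord0 in
       let l2 : {mpoly {poly K}[2]} := 'X_ord_max in
       let sg (s : {mpoly {poly K}[2]}) x y :=
         lsubst (fun=> s) (sigma [tuple x; y]) in
       m3' [tuple a; b; c] = m3 [tuple a; b; c]
         + lext (fun x => lam m01 l1 a x) (sg l2 b c)
         - lext (fun x => sg (l1 + l2) x c) (lam m00 l1 a b)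
         + lext (fun x => sg l1 a x) (lam m00 l2 b c)
         - lext (fun x => lam m10 (l1 + l2) x c) (sg l1 a b)) :
  ops_equiv (@Operations V0 V1 m00 m01 m10 m3) (@Operations V0 V1 m00 m01 m10 m3').

Definition skel_equiv (X Y : skeletal) : Prop :=
  ops_equiv (skel_ops X) (skel_ops Y).

Record cocycle_tuple := CocycleTuple {
  ct_alg : assoc_conf_alg;
  ct_mod : conf_bimodule ct_alg;
  ct_cocycle : cocycle ct_mod 2
}.

Definition ct_ops (T : cocycle_tuple) : operations :=
  Operations (@aca_mul (ct_alg T)) (@cb_l _ (ct_mod T)) (@cb_r _ (ct_mod T))
             (ct_cocycle T).

Record class_tuple := ClassTuple {
  cl_alg : assoc_conf_alg;
  cl_mod : conf_bimodule cl_alg;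
  cl_class : cohomology cl_mod 1
}.

Definition ct_class (T : cocycle_tuple) : class_tuple :=
  ClassTuple (qclass (@cohomologous _ (ct_mod T) 1) (ct_cocycle T)).

End Conformal.

Arguments assoc_conf_alg K : clear implicits.
Arguments two_term K : clear implicits.
Arguments skeletal K : clear implicits.
Arguments operations K : clear implicits.
Arguments cocycle_tuple K : clear implicits.
Arguments class_tuple K : clear implicits.

(* Main.v *)
(** For [beta = 0] the axioms of a 2-term A_infinity-conformal algebra say that
    [mu_2] is associative on [A_0] and makes [A_1] a bimodule, and the pentagon
    axiom is [delta mu_3 = 0]; the equivalence formula is
    [mu_3' = mu_3 + delta sigma].  A skeletal algebra and a cocycle tuple are
    each determined by their operations, and the operations that arise are
    characterised by the same axioms [skeletal_ops] in both cases.  All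
    comparisons are made between operations, which avoids equalities between
    modules over different algebras. *)

Require Import Defs.
From HB Require Import structures.
From mathcomp Require Import all_boot all_order all_algebra.
From mathcomp Require Import mpoly.
From mathcomp Require Import boolp.
From mathcomp Require Import complex reals.

Set Implicit Arguments.
Unset Strict Implicit.
Unset Printing Implicit Defensive.

Import GRing.Theory.
Local Open Scope ring_scope.

(** * Additivity of the operations on lambda-polynomials *)

Section LambdaAdditive.
Context {R : comNzRingType}.
Implicit Types (V W : lmodType R).

Lemma eq_lext n V W (g h : V -> {lpoly W[n]}) : g =1 h -> lext g =1 lext h.
Proof. by move=> /funext ->. Qed.

(** Compatibility with differences forces [g 0 = 0], hence additivity of [g], and [lsumD] then
    applies to [lext g]. *)
Lemma lext_subr n V W (g : V -> {lpoly W[n]}) :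
  {morph g : x y / x - y} -> {morph lext g : p q / p - q}.
Proof.
move=> gB; have g0 : g 0 = 0 by rewrite -{1}(subrr 0) gB subrr.
have gN x : g (- x) = - g x by rewrite -sub0r gB g0 sub0r.
have gD : {morph g : x y / x + y}.
  by move=> x y; rewrite -{1}(opprK y) gB gN opprK.
have extD : {morph lext g : p q / p + q}.
  by move=> p q; apply: lsumD => m x y; rewrite gD scalerDr.
by move=> p q; apply/eqP; rewrite eq_sym subr_eq -extD subrK.
Qed.

Lemma lext_sub n V W (g h : V -> {lpoly W[n]}) q :
  lext (fun x => g x - h x) q = lext g q - lext h q.
Proof.
rewrite /lext !lsum.unlock -sumrB; apply: eq_bigr => m _.
by rewrite scalerBr.
Qed.

Lemma lsubst_subr k n V (u : 'I_k -> {mpoly R[n]}) :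
  {morph @lsubst R k n V u : p q / p - q}.
Proof.
have substD : {morph @lsubst R k n V u : p q / p + q}.
  by move=> p q; apply: lsumD => m x y; rewrite lmonD scalerDr.
by move=> p q; apply/eqP; rewrite eq_sym subr_eq -substD subrK.
Qed.

Lemma lmap_eq0 n V W (h : V -> W) (q : {lpoly V[n]}) :
  (forall x, h x = 0) -> lmap h q = 0.
Proof.
move=> h0; rewrite /lmap /lext lsum.unlock big1 // => m _.
by rewrite h0 lmon0 scaler0.
Qed.

End LambdaAdditive.

(** * Elementary consequences of conformal sesquilinearity *)

Section Sesquilinear.
Context {K : fieldType}.
Implicit Types (U V W : lmodType {poly K}).

Lemma sesquilinear2_subl U V W (f : U -> V -> {lpoly W[1]}) y :
  sesquilinear2 f -> {morph f^~ y : x x' / x - x'}.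
Proof.
case=> fl _ _ _ x x' /=.
(* The difference is brought to the shape of the linearity axiom, with scalar -1. *)
have -> : x - x' = (-1)%:P *: x' + x by rewrite polyCN scaleN1r addrC.
by rewrite fl polyCN !raddfN /= scaleN1r addrC.
Qed.

Lemma sesquilinear2_subr U V W (f : U -> V -> {lpoly W[1]}) x :
  sesquilinear2 f -> {morph f x : y y' / y - y'}.
Proof.
case=> _ fr _ _ y y' /=.
have -> : y - y' = (-1)%:P *: y' + y by rewrite polyCN scaleN1r addrC.
by rewrite fr polyCN !raddfN /= scaleN1r addrC.
Qed.

Lemma sesquilinear2_0l U V W (f : U -> V -> {lpoly W[1]}) y :
  sesquilinear2 f -> f 0 y = 0.
Proof. by move=> /sesquilinear2_subl fB; rewrite -{1}(subrr 0) fB subrr. Qed.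

Lemma sesquilinear2_0r U V W (f : U -> V -> {lpoly W[1]}) x :
  sesquilinear2 f -> f x 0 = 0.
Proof. by move=> /sesquilinear2_subr fB; rewrite -{1}(subrr 0) fB subrr. Qed.

Lemma tset_id n (T : Type) (i : 'I_n) (a : n.-tuple T) : tset i (tnth a i) a = a.
Proof. by apply: eq_from_tnth => j; rewrite tnth_mktuple; case: eqP => // ->. Qed.

(** Additivity in slot [i], taken at two zero arguments, gives u = u + u for the value u there. *)
Lemma sesquilinear_eq0 n V W (phi : n.+1.-tuple V -> {lpoly W[n]}) i a :
  sesquilinear phi -> tnth a i = 0 -> phi a = 0.
Proof.
case=> phiD _ _ ai0; rewrite -(tset_id i a) ai0.
have := phiD i 1 0 0 a; rewrite scaler0 addr0 scale1r => e.
by apply: (@addrI _ (phi (tset i 0 a))); rewrite addr0.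
Qed.

Lemma sesquilinear_zero n V W :
  sesquilinear (fun _ : n.+1.-tuple V => 0 : {lpoly W[n]}).
Proof. by split=> *; rewrite ?scaler0 ?addr0. Qed.

Lemma sesquilinear_sub n V W (phi psi : n.+1.-tuple V -> {lpoly W[n]}) :
  sesquilinear phi -> sesquilinear psi -> sesquilinear (fun a => phi a - psi a).
Proof.
move=> [D1 l1 r1] [D2 l2 r2]; split.
- by move=> i c x y a; rewrite D1 D2 scalerBr opprD addrACA.
- by move=> i x a i'; rewrite l1 l2 scalerBr.
- by move=> x a; rewrite r1 r2 scalerBr.
Qed.

End Sesquilinear.

(** * The Hochschild differential: additivity, cohomologous cocycles, low degrees *)

Section HochschildDifferential.
Context {K : fieldType} {A : assoc_conf_alg K} {M : conf_bimodule A}.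

(** In the two outer summands the difference passes through [lext] because the actions are
    sesquilinear; in the inner ones [phi] sits inside the extended map, so the difference is taken
    pointwise. *)
Lemma hdelta_sub n (phi psi : n.+1.-tuple A -> {lpoly M[n]}) a :
  hdelta (fun b => phi b - psi b) a = hdelta phi a - hdelta psi a.
Proof.
rewrite /hdelta !lsubst_subr.
rewrite lext_subr; last first.
  by move=> x y; rewrite /lam (sesquilinear2_subr _ (cb_l_sesq M)) lsubst_subr.
rewrite [X in _ + _ *: X]lext_subr; last first.
  by move=> x y; rewrite /lam (sesquilinear2_subl _ (cb_r_sesq M)) lsubst_subr.
under eq_bigr => i _.
  under [X in lext X _]funext => x do rewrite lsubst_subr.
  rewrite lext_sub scalerBr; over.
rewrite sumrB scalerBr [X in X + _ = _]addrACA -opprD.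
by rewrite [LHS]addrACA -opprD.
Qed.

Lemma hdelta0 n a : hdelta (fun _ : n.+1.-tuple A => 0 : {lpoly M[n]}) a = 0.
Proof.
have -> : (fun _ : n.+1.-tuple A => 0 : {lpoly M[n]}) = (fun _ => 0 - 0).
  by apply: funext => b; rewrite subr0.
by rewrite hdelta_sub subrr.
Qed.

(** Zero and differences provide all witnesses for the equivalence relation: [0] for reflexivity,
    [0 - s] for symmetry and [s - (0 - t)], the sum, for transitivity. *)
Definition cochain_zero n : cochain M n := Cochain (@sesquilinear_zero K n A M).

Definition cochain_sub n (s t : cochain M n) : cochain M n :=
  Cochain (sesquilinear_sub (cochain_sesq s) (cochain_sesq t)).

Lemma cohomologous_refl n (phi : cocycle M n.+1) : cohomologous phi phi.
Proof. by exists (cochain_zero n) => a; rewrite hdelta0 addr0. Qed.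

Lemma cohomologous_sym n (phi psi : cocycle M n.+1) :
  cohomologous phi psi -> cohomologous psi phi.
Proof.
case=> s e; exists (cochain_sub (cochain_zero n) s) => a.
by rewrite hdelta_sub hdelta0 sub0r e addrK.
Qed.

Lemma cohomologous_trans n (phi psi chi : cocycle M n.+1) :
  cohomologous phi psi -> cohomologous psi chi -> cohomologous phi chi.
Proof.
case=> s es [t et]; exists (cochain_sub s (cochain_sub (cochain_zero n) t)) => a.
by rewrite !hdelta_sub hdelta0 sub0r opprK addrA -es et.
Qed.

(** The right side is the correction term of [ops_equiv], so that equivalence of skeletal algebras
    can be read as a coboundary. *)
Lemma hdelta1E (s : 2.-tuple A -> {lpoly M[1]}) a b c :
  let l1 : {mpoly {poly K}[2]} := 'X_ord0 in
  let l2 : {mpoly {poly K}[2]} := 'X_ord_max in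
  let sg (p : {mpoly {poly K}[2]}) x y := lsubst (fun=> p) (s [tuple x; y]) in
  hdelta s [tuple a; b; c] =
    lext (fun x => lam (@cb_l _ _ M) l1 a x) (sg l2 b c)
    - lext (fun x => sg (l1 + l2) x c) (lam (@aca_mul _ A) l1 a b)
    + lext (fun x => sg l1 a x) (lam (@aca_mul _ A) l2 b c)
    - lext (fun x => lam (@cb_r _ _ M) (l1 + l2) x c) (sg l1 a b).
Proof.
move=> l1 l2 sg; rewrite /hdelta !big_ord_recl !big_ord0 !addr0.
have -> : lift ord0 ord0 = ord_max :> 'I_2 by exact: val_inj.
rewrite expr1 sqrrN expr1n -signr_odd expr1 !scaleN1r scale1r addrA.
have -> : [tuple of behead [tuple a; b; c]] = [tuple b; c] by exact: val_inj.
rewrite !(tnth_nth a) /thead (tnth_nth a) /=.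
(* A substitution for a single variable is constant, hence fixed by its value at [ord0]. *)
have vE (f : 'I_1 -> {mpoly {poly K}[2]}) p : f ord0 = p -> f = fun=> p.
  by move=> <-; apply: funext => j; rewrite (ord1 j).
rewrite (vE (fun j => 'X_(lift ord0 j)) l2); last by congr 'X_(_); exact: val_inj.
rewrite (vE (fun j => 'X_(widen_ord _ j)) l1); last by congr 'X_(_); exact: val_inj.
rewrite (vE (merge_var ord0) (l1 + l2)); last first.
  by rewrite /merge_var /=; congr ('X_(_) + 'X_(_)); exact: val_inj.
rewrite (vE (merge_var ord_max) l1); last first.
  by rewrite /merge_var /=; congr 'X_(_); exact: val_inj.
have -> : [tuple tnth [tuple a; b; c] (widen_ord (leqnSn 2) j) | j < 2] =
    [tuple a; b].
  by apply: eq_from_tnth => -[[|[|//]] ?]; rewrite tnth_mktuple.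
have m0 x : merge_arg ord0 x [tuple a; b; c] = [tuple x; c].
  by apply: eq_from_tnth => -[[|[|//]] ?]; rewrite tnth_mktuple.
have m1 x : merge_arg ord_max x [tuple a; b; c] = [tuple a; x].
  by apply: eq_from_tnth => -[[|[|//]] ?]; rewrite tnth_mktuple.
rewrite (eq_lext (h := fun x => sg (l1 + l2) x c)); last by move=> x; rewrite m0.
rewrite [X in _ + X - _](eq_lext (h := fun x => sg l1 a x)); first by [].
by move=> x; rewrite m1.
Qed.

(** The five terms are grouped as the right side of the pentagon axiom minus its left side, so that
    vanishing of the differential is that axiom. *)
Lemma hdelta2E (phi : 3.-tuple A -> {lpoly M[2]}) a b c d :
  let l1 : {mpoly {poly K}[3]} := 'X_(inord 0) in
  let l2 : {mpoly {poly K}[3]} := 'X_(inord 1) in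
  let l3 : {mpoly {poly K}[3]} := 'X_(inord 2) in
  let phi_at (p q : {mpoly {poly K}[3]}) x y z :=
    lsubst (tnth [tuple p; q]) (phi [tuple x; y; z]) in
  hdelta phi [tuple a; b; c; d] =
    lext (fun x => lam (@cb_r _ _ M) (l1 + l2 + l3) x d) (phi_at l1 l2 a b c)
    + lext (fun x => lam (@cb_l _ _ M) l1 a x) (phi_at l2 l3 b c d)
    - (lext (fun x => phi_at (l1 + l2) l3 x c d) (lam (@aca_mul _ A) l1 a b)
       - lext (fun x => phi_at l1 (l2 + l3) a x d) (lam (@aca_mul _ A) l2 b c)
       + lext (fun x => phi_at l1 l2 a b x) (lam (@aca_mul _ A) l3 c d)).
Proof.
move=> l1 l2 l3 phi_at; rewrite /hdelta !big_ord_recl !big_ord0 !addr0.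
have vE (f : 'I_2 -> {mpoly {poly K}[3]}) p q :
    f ord0 = p -> f ord_max = q -> f = tnth [tuple p; q].
  move=> <- <-; apply: funext => -[[|[|//]] i2]; rewrite (tnth_nth 0) /=;
    congr f; exact: val_inj.
have XE (i j : 'I_3) : i = j :> nat -> 'X_i = 'X_j :> {mpoly {poly K}[3]}.
  by move=> /val_inj ->.
rewrite (vE (fun j : 'I_3.-1 => 'X_(lift ord0 j)) l2 l3);
  try by apply: XE; rewrite /= inordK.
rewrite (vE (fun j => 'X_(widen_ord _ j)) l1 l2);
  try by apply: XE; rewrite /= inordK.
rewrite (vE (merge_var ord0) (l1 + l2) l3);
  try (rewrite /merge_var /=; try congr (_ + _);
       by apply: XE; rewrite /= inordK).
rewrite (vE (merge_var (lift ord0 ord0)) l1 (l2 + l3));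
  try (rewrite /merge_var /=; try congr (_ + _);
       by apply: XE; rewrite /= inordK).
rewrite (vE (merge_var (lift ord0 (lift ord0 ord0))) l1 l2);
  try (rewrite /merge_var /=; by apply: XE; rewrite /= inordK).
rewrite (XE ord0 (inord 0)) ?inordK // (XE (lift ord0 ord0) (inord 1)) ?inordK //.
rewrite (XE (lift ord0 (lift ord0 ord0)) (inord 2)) ?inordK // -/l1 -/l2 -/l3.
have -> : [tuple of behead [tuple a; b; c; d]] = [tuple b; c; d] by exact: val_inj.
rewrite !(tnth_nth a) /thead (tnth_nth a) /=.
rewrite expr1 sqrrN expr1n -signr_odd expr1 -signr_odd expr0 !scaleN1r !scale1r.
(* The alternating sum, regrouped: [x] and [w] are the left and right action terms, [y], [z], [t]
   the three inner products. *)
have sgn (V : zmodType) (x y z t w : V) :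
    x + (- y + (z - t)) + w = w + x - (y - z + t).
  by rewrite opprD opprB addrC addrA [- y + _]addrA [- y + z]addrC.
rewrite sgn [X in lam _ X]addrA.
have -> : [tuple tnth [tuple a; b; c; d] (widen_ord (leqnSn 3) j) | j < 3] =
    [tuple a; b; c].
  by apply: eq_from_tnth => -[[|[|[|//]]] ?]; rewrite tnth_mktuple.
have m0 x : merge_arg ord0 x [tuple a; b; c; d] = [tuple x; c; d].
  by apply: eq_from_tnth => -[[|[|[|//]]] ?]; rewrite tnth_mktuple.
have m1 x : merge_arg (lift ord0 ord0) x [tuple a; b; c; d] = [tuple a; x; d].
  by apply: eq_from_tnth => -[[|[|[|//]]] ?]; rewrite tnth_mktuple.
have m2 x : merge_arg (lift ord0 (lift ord0 ord0)) x [tuple a; b; c; d] =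
    [tuple a; b; x].
  by apply: eq_from_tnth => -[[|[|[|//]]] ?]; rewrite tnth_mktuple.
rewrite (eq_lext (h := fun x => phi_at (l1 + l2) l3 x c d)); last first.
  by move=> x; rewrite m0.
rewrite [X in _ - (_ - X + _)](eq_lext (h := fun x => phi_at l1 (l2 + l3) a x d));
  last by move=> x; rewrite m1.
rewrite [X in _ - (_ + X)](eq_lext (h := fun x => phi_at l1 l2 a b x)) //.
by move=> x; rewrite m2.
Qed.

End HochschildDifferential.

(** * Cocycle tuples and their operations *)

Section Skeletal.
Context {K : fieldType}.
Implicit Types (O : operations K).

(** The pentagon axiom of [two_term], restated for bare operations so that it also applies to those
    of a cocycle tuple. *)
Definition pentagon O : Prop := forall a b c d : op0 O,
  let l1 : {mpoly {poly K}[3]} := 'X_(inord 0) in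
  let l2 : {mpoly {poly K}[3]} := 'X_(inord 1) in
  let l3 : {mpoly {poly K}[3]} := 'X_(inord 2) in
  let op3_at (p q : {mpoly {poly K}[3]}) x y z :=
    lsubst (tnth [tuple p; q]) (@op3 _ O [tuple x; y; z]) in
  lext (fun x => op3_at (l1 + l2) l3 x c d) (lam (@op00 _ O) l1 a b)
  - lext (fun x => op3_at l1 (l2 + l3) a x d) (lam (@op00 _ O) l2 b c)
  + lext (fun x => op3_at l1 l2 a b x) (lam (@op00 _ O) l3 c d) =
  lext (fun x => lam (@op10 _ O) (l1 + l2 + l3) x d) (op3_at l1 l2 a b c)
  + lext (fun x => lam (@op01 _ O) l1 a x) (op3_at l2 l3 b c d).

Record skeletal_ops O : Prop := SkeletalOps {
  so_sesq00 : sesquilinear2 (@op00 _ O);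
  so_sesq01 : sesquilinear2 (@op01 _ O);
  so_sesq10 : sesquilinear2 (@op10 _ O);
  so_sesq3 : sesquilinear (@op3 _ O);
  so_assoc : forall a b c,
    lam_r (@op00 _ O) (@op00 _ O) a b c =
    lam_l (@op00 _ O) (@op00 _ O) a b c;
  so_ll : forall a b m,
    lam_r (@op01 _ O) (@op01 _ O) a b m =
    lam_l (@op00 _ O) (@op01 _ O) a b m;
  so_lr : forall a m b,
    lam_r (@op01 _ O) (@op10 _ O) a m b =
    lam_l (@op01 _ O) (@op10 _ O) a m b;
  so_rr : forall m a b,
    lam_r (@op10 _ O) (@op00 _ O) m a b =
    lam_l (@op10 _ O) (@op10 _ O) m a b;
  so_pentagon : pentagon O
}.

Definition ops_alg O (h : skeletal_ops O) : assoc_conf_alg K :=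
  AssocConfAlg (so_sesq00 h) (so_assoc h).

Definition ops_mod O (h : skeletal_ops O) : conf_bimodule (ops_alg h) :=
  @ConfBimodule K (ops_alg h) _ _ _ (so_sesq01 h) (so_sesq10 h)
    (so_ll h) (so_lr h) (so_rr h).

Definition ops_cochain O (h : skeletal_ops O) : cochain (ops_mod h) 2 :=
  @Cochain K (ops_alg h) (ops_mod h) 2 _ (so_sesq3 h).

Lemma pentagon_closed (A : assoc_conf_alg K) (M : conf_bimodule A)
    (phi : 3.-tuple A -> {lpoly M[2]}) :
  pentagon (Operations (@aca_mul _ A) (@cb_l _ _ M) (@cb_r _ _ M) phi) ->
  forall a, hdelta phi a = 0.
Proof.
move=> pent a.
(* The pentagon is stated for four separate arguments, so the tuple is written out. *)
have -> : a = [tuple tnth a (inord 0); tnth a (inord 1); tnth a (inord 2);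
                     tnth a (inord 3)].
  apply: eq_from_tnth => i; rewrite [RHS](tnth_nth (tnth a i)).
  by case: i => -[|[|[|[|//]]]] i4 /=; congr tnth; apply: val_inj; rewrite /= inordK.
by apply/eqP; rewrite hdelta2E subr_eq0 eq_sym; apply/eqP; exact: pent.
Qed.

Lemma closed_pentagon (A : assoc_conf_alg K) (M : conf_bimodule A)
    (phi : 3.-tuple A -> {lpoly M[2]}) :
  (forall a, hdelta phi a = 0) ->
  pentagon (Operations (@aca_mul _ A) (@cb_l _ _ M) (@cb_r _ _ M) phi).
Proof.
move=> phi0 a b c d; apply/eqP; rewrite eq_sym -subr_eq0; apply/eqP.
by have := phi0 [tuple a; b; c; d]; rewrite hdelta2E.
Qed.

Lemma ops_closed O (h : skeletal_ops O) a : hdelta (ops_cochain h) a = 0.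
Proof. by apply: pentagon_closed; exact: (so_pentagon h). Qed.

Definition ops_tuple O (h : skeletal_ops O) : cocycle_tuple K :=
  CocycleTuple (Cocycle (@ops_closed O h)).

Lemma ct_opsK O (h : skeletal_ops O) : ct_ops (ops_tuple h) = O.
Proof. by case: O h. Qed.

Lemma skeletal_ct_ops (T : cocycle_tuple K) : skeletal_ops (ct_ops T).
Proof.
case: T => A M th; split => /=.
- exact: aca_sesq.
- exact: cb_l_sesq.
- exact: cb_r_sesq.
- exact: cochain_sesq.
- exact: aca_assoc.
- exact: cb_ll.
- exact: cb_lr.
- exact: cb_rr.
exact: (closed_pentagon (cocycle_closed th)).
Qed.

(** Rebuilding from the operations changes only proof fields, which proof irrelevance identifies. *)
Lemma ops_tupleK (T : cocycle_tuple K) (h : skeletal_ops (ct_ops T)) :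
  ops_tuple h = T.
Proof.
case: T h => -[A mul sesq assoc] [M l r ls rs ll lr rr] [[f fs] fc] h.
move: (@ops_closed _ h); rewrite /ops_tuple /ops_cochain /ops_mod /ops_alg /=.
move: (so_sesq00 h) (so_assoc h) (so_sesq01 h) (so_sesq10 h) (so_ll h) (so_lr h)
  (so_rr h) (so_sesq3 h) => /= p1 p2 p3 p4 p5 p6 p7 p8.
(* The algebra comes first, being a parameter of the types of the bimodule and the cocycle. *)
have e1 := Prop_irrelevance p1 sesq; have e2 := Prop_irrelevance p2 assoc.
subst p1 p2.
have e3 := Prop_irrelevance p3 ls; have e4 := Prop_irrelevance p4 rs.
have e5 := Prop_irrelevance p5 ll; have e6 := Prop_irrelevance p6 lr.
have e7 := Prop_irrelevance p7 rr; have e8 := Prop_irrelevance p8 fs.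
by subst p3 p4 p5 p6 p7 p8 => p9; congr CocycleTuple;
  congr Cocycle; exact: Prop_irrelevance.
Qed.

(** * Skeletal algebras and their operations *)

Lemma linear_eq (R : nzRingType) (U V : lmodType R) (f g : {linear U -> V}) :
  f =1 g -> f = g.
Proof.
case: f g => f cf [g cg] /= /funext e; subst g.
(* Once the functions agree, only the proofs of additivity and homogeneity are left to compare. *)
case: cf cg => [[a] [b]] [[a'] [b']].
by rewrite (Prop_irrelevance a a') (Prop_irrelevance b b').
Qed.

(** Both sides of every axiom involving the differential vanish: by sesquilinearity at a zero
    argument, or by associativity and the bimodule identities. [Defined] keeps the operations
    computable for [skel_opsK]. *)
Definition ops_two_term O (h : skeletal_ops O) : two_term K.
Proof.
apply: (@TwoTerm K (op0 O) (op1 O) \0 (@op00 _ O) (@op01 _ O) (@op10 _ O)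
  (@op3 _ O) (so_sesq00 h) (so_sesq01 h) (so_sesq10 h)
  (so_sesq3 h)).
- by move=> a m; rewrite lmap_eq0 // sesquilinear2_0r //; exact: so_sesq00.
- by move=> m a; rewrite lmap_eq0 // sesquilinear2_0l //; exact: so_sesq00.
- move=> m m'; rewrite sesquilinear2_0l; last exact: so_sesq01.
  by rewrite sesquilinear2_0r //; exact: so_sesq10.
- by move=> a b c; rewrite lmap_eq0 // (so_assoc h) subrr.
- move=> a b m; rewrite (so_ll h) subrr.
  by apply: (sesquilinear_eq0 (i := ord_max) (so_sesq3 h)); rewrite (tnth_nth 0).
- move=> a m c; rewrite (so_lr h) subrr.
  apply: (sesquilinear_eq0 (i := inord 1) (so_sesq3 h)).
  by rewrite (tnth_nth 0) /= inordK.
- move=> m b c; rewrite (so_rr h) subrr.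
  by apply: (sesquilinear_eq0 (i := ord0) (so_sesq3 h)); rewrite (tnth_nth 0).
exact: (so_pentagon h).
Defined.

Definition ops_skeletal O (h : skeletal_ops O) : skeletal K :=
  @Skeletal K (ops_two_term h) (fun=> erefl).

Lemma skel_opsK O (h : skeletal_ops O) : skel_ops (ops_skeletal h) = O.
Proof. by case: O h. Qed.

(** Conversely, with zero differential the axioms relating it to [mu3] say that the two bracketings
    differ by zero. *)
Lemma skeletal_skel_ops (X : skeletal K) : skeletal_ops (skel_ops X).
Proof.
case: X => X X0; split => /=.
- exact: mu00_sesq.
- exact: mu01_sesq.
- exact: mu10_sesq.
- exact: mu3_sesq.
- move=> a b c; apply/esym/eqP; rewrite -subr_eq0; apply/eqP.
  by rewrite -tt_mu3_beta lmap_eq0.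
- move=> a b m; apply/esym/eqP; rewrite -subr_eq0; apply/eqP.
  rewrite -tt_mu3_001 X0 (sesquilinear_eq0 (i := ord_max)) ?(tnth_nth 0) //.
  exact: mu3_sesq.
- move=> a m c; apply/esym/eqP; rewrite -subr_eq0; apply/eqP.
  rewrite -tt_mu3_010 X0 (sesquilinear_eq0 (i := inord 1)).
  - by [].
  - exact: mu3_sesq.
  by rewrite (tnth_nth 0) /= inordK.
- move=> m b c; apply/esym/eqP; rewrite -subr_eq0; apply/eqP.
  rewrite -tt_mu3_100 X0 (sesquilinear_eq0 (i := ord0)) ?(tnth_nth 0) //.
  exact: mu3_sesq.
exact: tt_pentagon.
Qed.

Lemma skel_alg_inj : injective (@skel_alg K).
Proof.
case=> [X bX] [Y bY] /= e; subst Y.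
by rewrite (Prop_irrelevance bX bY).
Qed.

(** Apart from proofs, [skel_ops] forgets only the differential, and that is the zero map. *)
Lemma ops_skeletalK (X : skeletal K) (h : skeletal_ops (skel_ops X)) :
  ops_skeletal h = X.
Proof.
case: X h => -[V0 V1 beta m00 m01 m10 m3].
move=> a1 a2 a3 a4 a5 a6 a7 a8 a9 a10 a11 a12 beta0 h /=.
have e : beta = \0 :> {linear V1 -> V0} by apply: linear_eq => m; rewrite beta0.
subst beta; apply: skel_alg_inj; rewrite /= /ops_two_term.
by congr TwoTerm; exact: Prop_irrelevance.
Qed.

(** Each tuple is rebuilt from its operations, and the two proofs of [skeletal_ops] used for this
    agree by proof irrelevance. *)
Lemma ct_ops_inj : injective (@ct_ops K).
Proof.
move=> S T e; rewrite -(ops_tupleK (skeletal_ct_ops S)).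
rewrite -(ops_tupleK (skeletal_ct_ops T)).
move: (skeletal_ct_ops S) (skeletal_ct_ops T); rewrite e => h h'.
by rewrite (Prop_irrelevance h h').
Qed.

Lemma skel_ops_inj : injective (@skel_ops K).
Proof.
move=> X Y e; rewrite -(ops_skeletalK (skeletal_skel_ops X)).
rewrite -(ops_skeletalK (skeletal_skel_ops Y)).
move: (skeletal_skel_ops X) (skeletal_skel_ops Y); rewrite e => h h'.
by rewrite (Prop_irrelevance h h').
Qed.

(** * The bijection between skeletal algebras and cocycle tuples *)

Definition skel_tuple (X : skeletal K) : cocycle_tuple K :=
  ops_tuple (skeletal_skel_ops X).

Definition tuple_skel (T : cocycle_tuple K) : skeletal K :=
  ops_skeletal (skeletal_ct_ops T).

Lemma ct_ops_skel_tuple X : ct_ops (skel_tuple X) = skel_ops X.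
Proof. exact: ct_opsK. Qed.

Lemma skel_ops_tuple_skel T : skel_ops (tuple_skel T) = ct_ops T.
Proof. exact: skel_opsK. Qed.

Lemma skel_tupleK : cancel skel_tuple tuple_skel.
Proof.
by move=> X; apply: skel_ops_inj; rewrite skel_ops_tuple_skel ct_ops_skel_tuple.
Qed.

Lemma tuple_skelK : cancel tuple_skel skel_tuple.
Proof.
by move=> T; apply: ct_ops_inj; rewrite ct_ops_skel_tuple skel_ops_tuple_skel.
Qed.

(** * Equivalence of skeletal algebras and cohomology classes *)

Lemma ct_class_cohomologous (A : assoc_conf_alg K) (M : conf_bimodule A)
    (phi psi : cocycle M 2) :
  cohomologous phi psi ->
  ct_class (CocycleTuple phi) = ct_class (CocycleTuple psi).
Proof.
move=> e; congr ClassTuple; apply: eq_exist; apply: funext => chi; apply: propext.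
(* Classes are predicates, so they are equal when they have the same members. *)
split; [apply: cohomologous_trans | exact: cohomologous_trans].
exact: cohomologous_sym.
Qed.

Lemma ops_equiv_cohomologous (A : assoc_conf_alg K) (M : conf_bimodule A)
    (phi psi : cocycle M 2) :
  cohomologous phi psi ->
  ops_equiv (ct_ops (CocycleTuple phi)) (ct_ops (CocycleTuple psi)).
Proof.
case=> s e; apply: (OpsEquiv (cochain_sesq s)) => a b c.
by move=> l1 l2 sg; rewrite e hdelta1E !addrA.
Qed.

(* Stated along the indices of [ops_equiv], so that its elimination produces no
   equality between dependent pairs of a module and an operation. *)
Lemma ops_equiv_class (O P : operations K) (hO : skeletal_ops O)
    (hP : skeletal_ops P) :
  ops_equiv O P -> ct_class (ops_tuple hO) = ct_class (ops_tuple hP).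
Proof.
move=> e; case: e hO hP => V0 V1 m00 m01 m10 m3 m3' s ss e hO hP.
(* The second cocycle is placed over the algebra and bimodule built from [hO], so that both cocycles
   live in one complex. *)
pose psi := Cocycle
  (cocycle_cochain := @Cochain K (ops_alg hO) (ops_mod hO) 2 m3' (so_sesq3 hP))
  (@pentagon_closed (ops_alg hO) (ops_mod hO) m3' (so_pentagon hP)).
have -> : ops_tuple hP = CocycleTuple psi by exact: ct_ops_inj.
apply: ct_class_cohomologous.
exists (@Cochain K (ops_alg hO) (ops_mod hO) 1 s ss) => a.
have -> : a = [tuple tnth a ord0; tnth a (inord 1); tnth a ord_max].
  apply: eq_from_tnth => i; rewrite [RHS](tnth_nth (tnth a i)).
  by case: i => -[|[|[|//]]] i4 /=; congr tnth; apply: val_inj; rewrite /= ?inordK.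
by rewrite hdelta1E /= e !addrA.
Qed.

(* An equality of class tuples is only ever used through this predicate, whose
   second argument does not depend on the first. *)
Definition class_ops (c : class_tuple K) (O : operations K) : Prop :=
  exists2 phi : cocycle (cl_mod c) 2,
    sval (cl_class c) phi & ct_ops (CocycleTuple phi) = O.

(** [class_ops] holds at the class of [T] by reflexivity; rewriting it to the class of [S] yields a
    cocycle over the bimodule of [S], cohomologous to that of [S], with the operations of [T]. *)
Lemma class_ops_equiv (S T : cocycle_tuple K) :
  ct_class S = ct_class T -> ops_equiv (ct_ops S) (ct_ops T).
Proof.
move=> e; have [phi Sphi <-] : class_ops (ct_class S) (ct_ops T).
  by rewrite e; case: T {e} => A M th; exists th => //; exact: cohomologous_refl.
by case: S phi Sphi {e} => A M th phi; exact: ops_equiv_cohomologous.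
Qed.

End Skeletal.

(** * Passage to equivalence classes *)

Lemma inj_surj_bij (T U : Type) (f : T -> U) :
  injective f -> (forall y, exists x, f x = y) -> bijective f.
Proof.
move=> f_inj f_surj; have gK y := svalP (cid (f_surj y)).
(* The inverse picks preimages by choice. *)
by exists (fun y => sval (cid (f_surj y))) => // x; apply: f_inj; rewrite gK.
Qed.

Section Quotient.
Context {K : fieldType}.

(** This makes [skel_equiv] the kernel of a map, hence an equivalence relation, and makes the
    induced map on classes well defined and injective. *)
Lemma skel_equiv_class (X Y : skeletal K) :
  skel_equiv X Y <-> ct_class (skel_tuple X) = ct_class (skel_tuple Y).
Proof.
split=> [|/class_ops_equiv]; first exact: ops_equiv_class.
by rewrite !ct_ops_skel_tuple.
Qed.

Definition quot_class (q : quot (@skel_equiv K)) : class_tuple K :=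
  ct_class (skel_tuple (sval (cid (svalP q)))).

Lemma quot_class_qclass X :
  quot_class (qclass (@skel_equiv K) X) = ct_class (skel_tuple X).
Proof.
(* The chosen representative [Y] has the same class as [X], which reduces the claim to
   [skel_equiv X X]. *)
rewrite /quot_class; case: cid => Y /= e; apply/skel_equiv_class.
by rewrite -e; apply/skel_equiv_class.
Qed.

Lemma quot_class_bij : bijective quot_class.
Proof.
apply: inj_surj_bij => [[S pS] [S' pS']|c].
  case: (pS) (pS') => X eS [Y eS'] ; subst S S'.
  rewrite -![exist _ _ _]/(qclass _ _) !quot_class_qclass => e.
  apply: eq_exist; apply: funext => Z; apply: propext.
  by rewrite !skel_equiv_class e.
case: c => A M [S pS]; case: (pS) => phi e; subst S.
(* Surjectivity: any cocycle representing the class gives a skeletal algebra above it. *)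
exists (qclass (@skel_equiv K) (tuple_skel (CocycleTuple phi))).
by rewrite quot_class_qclass tuple_skelK; congr ClassTuple; exact: eq_exist.
Qed.

End Quotient.

(** Here [R[i]] is the field of complex numbers. Since [ct_ops] is injective, the condition on
    operations determines [F]; the last one determines [G], as every class has a representative. *)
Theorem theorem4p3 (R : realType) :
  exists F : skeletal R[i] -> cocycle_tuple R[i],
    [/\ bijective F,
        forall X : skeletal R[i], ct_ops (F X) = skel_ops X
      & exists G : quot (@skel_equiv R[i]) -> class_tuple R[i],
          bijective G /\
          forall X : skeletal R[i], G (qclass (@skel_equiv R[i]) X) = ct_class (F X)].
Proof.
exists (@skel_tuple R[i]); split.
- by exists (@tuple_skel R[i]); [exact: skel_tupleK | exact: tuple_skelK].
- exact: ct_ops_skel_tuple.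
exists (@quot_class R[i]); split; first exact: quot_class_bij.
exact: quot_class_qclass.
Qed.
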